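(* Let $R$ be an associative ring with unit, let $\mathcal{B}$ be a class of right $R$-modules, and assume that the class $\mathcal{GF}_{\mathcal{B}}(R)$ of Gorenstein $\mathcal{B}$-flat left $R$-modules is closed under extensions. Let $$\check{\mathcal{B}}:=\Big\{X\in\mathrm{Ch}(R^{op}) : X\simeq\bigoplus_{m\in\mathbb{Z}}S^m(B_m),\ B_m\in\mathcal{B}\Big\}.$$ Then $$\mathbf{GF}^{\otimes^{\cdot}}_{\check{\mathcal{B}}}(R)=\mathrm{Ch}(\mathcal{GF}_{\mathcal{B}}(R)),$$ i.e. the Gorenstein $\check{\mathcal{B}}$-flat complexes under $\otimes^{\cdot}$ are exactly the complexes all of whose components are Gorenstein $\mathcal{B}$-flat modules.
   Context: Complexes have differentials $\partial_m\colon X_m\to X_{m-1}$; $Z_m$ = cycles; $\mathrm{Ch}(R)$ is the category of complexes of left $R$-modules. The $m$-th sphere $S^m(M)$ is the complex with $M$ in degree $m$ and $0$ elsewhere. For $X\in\mathrm{Ch}(R^{op})$, $Y\in\mathrm{Ch}(R)$, $X\otimes^{\cdot}Y$ is the usual tensor product complex, $(X\otimes^{\cdot}Y)_m=\bigoplus_kX_k\otimes_RY_{m-k}$ with differential $x\otimes y\mapsto\partial x\otimes y+(-1)^kx\otimes\partial y$ ($x\in X_k$). A complex $L\in\mathrm{Ch}(R)$ is $\otimes^{\cdot}$-flat if $-\otimes^{\cdot}L$ is exact. A left module $M$ is Gorenstein $\mathcal{B}$-flat if $M=Z_0(F)$ for some exact complex $F$ of flat modules such that $B\otimes_RF$ is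 exact for all $B\in\mathcal{B}$. For a class $\mathbf{B}\subseteq\mathrm{Ch}(R^{op})$, $\mathbf{GF}^{\otimes^{\cdot}}_{\mathbf{B}}(R)$ is the class of Gorenstein $\mathbf{B}$-flat complexes under $\otimes^{\cdot}$: those $X=Z_0(F_\bullet)$ for some exact $F_\bullet\in\mathrm{Ch}(\mathrm{Ch}(R))$ with $\otimes^{\cdot}$-flat complexes as terms such that $B\otimes^{\cdot}F_\bullet$ (formed termwise) is exact for all $B\in\mathbf{B}$. For a class $\mathcal{X}$ of modules, $\mathrm{Ch}(\mathcal{X})$ is the class of complexes with components in $\mathcal{X}$. *)

(* Defs.v *)
From HB Require Import structures.
From mathcomp Require Import all_boot all_order all_algebra.
From mathcomp Require Import all_classical.
Set Implicit Arguments.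
Unset Strict Implicit.
Unset Printing Implicit Defensive.
Import GRing.Theory.
Local Open Scope ring_scope.
Local Open Scope quotient_scope.

(* Left R-modules are [lmodType R], right R-modules are [lmodType R^c] (with   *)
(* [x r] written [(r : R^c) *: x]), abelian groups are [lmodType int].  Since  *)
(* R is a [pzRingType], the zero ring is allowed.  Classically every module    *)
(* carries the choice structure required by [lmodType].                        *)

Section Modules.
Variable R : pzRingType.

Definition exact_at (U V W : lmodType R)
    (f : {linear U -> V}) (g : {linear V -> W}) : Prop :=
  forall y, g y = 0 <-> exists x, f x = y.

Definition short_exact (U V W : lmodType R)
    (f : {linear U -> V}) (g : {linear V -> W}) : Prop :=
  [/\ injective f, exact_at f g & forall z, exists y, g y = z].

Definition isomorphic (U V : lmodType R) : Prop :=
  exists f : {linear U -> V}, bijective f.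

Definition closed_under_extensions (G : lmodType R -> Prop) : Prop :=
  forall (U V W : lmodType R) (f : {linear U -> V}) (g : {linear V -> W}),
    short_exact f g -> G U -> G W -> G V.

Definition ker_pred (U V : lmodType R) (f : {linear U -> V}) : {pred U} :=
  fun x => f x == 0.

Fact ker_pred_submod (U V : lmodType R) (f : {linear U -> V}) :
  submod_closed (ker_pred f).
Proof.
split=> [|a x y]; first by rewrite unfold_in linear0.
by rewrite !unfold_in => /eqP fx /eqP fy; rewrite linearP fx fy scaler0 addr0.
Qed.

HB.instance Definition _ (U V : lmodType R) (f : {linear U -> V}) :=
  GRing.isSubmodClosed.Build R U (ker_pred f) (ker_pred_submod f).

Definition kernel (U V : lmodType R) (f : {linear U -> V}) : Type :=
  {x : U | ker_pred f x}.

HB.instance Definition _ (U V : lmodType R) (f : {linear U -> V}) :=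
  SubChoice.on (kernel f).
HB.instance Definition _ (U V : lmodType R) (f : {linear U -> V}) :=
  [SubChoice_isSubLmodule of kernel f by <:].

End Modules.

Section DirectSum.
Variables (R : pzRingType) (I : choiceType).

Definition dprod (A : I -> lmodType R) : Type := forall i, A i.

Section DirectProduct.
Variable A : I -> lmodType R.
Implicit Types f g h : dprod A.

HB.instance Definition _ := Choice.copy (dprod A) (forall i, A i).

Let add f g : dprod A := fun i => f i + g i.
Let opp f : dprod A := fun i => - f i.
Let zero : dprod A := fun=> 0.
Let scale (a : R) f : dprod A := fun i => a *: f i.

Let addA : associative add.
Proof. by move=> f g h; apply: functional_extensionality_dep => i; apply: addrA. Qed.
Let addC : commutative add.
Proof. by move=> f g; apply: functional_extensionality_dep => i; apply: addrC. Qed.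
Let add0 : left_id zero add.
Proof. by move=> f; apply: functional_extensionality_dep => i; apply: add0r. Qed.
Let addN : left_inverse zero opp add.
Proof. by move=> f; apply: functional_extensionality_dep => i; apply: addNr. Qed.

HB.instance Definition _ := GRing.isZmodule.Build (dprod A) addA addC add0 addN.

Let scaleA a b f : scale a (scale b f) = scale (a * b) f.
Proof. by apply: functional_extensionality_dep => i; apply: scalerA. Qed.
Let scale1 : left_id 1 scale.
Proof. by move=> f; apply: functional_extensionality_dep => i; apply: scale1r. Qed.
Let scaleDr : right_distributive scale +%R.
Proof. by move=> a f g; apply: functional_extensionality_dep => i; apply: scalerDr. Qed.
Let scaleDl f : {morph scale^~ f : a b / a + b}.
Proof. by move=> a b; apply: functional_extensionality_dep => i; apply: scalerDl. Qed.

HB.instance Definition _ :=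
  GRing.Zmodule_isLmodule.Build R (dprod A) scaleA scale1 scaleDr scaleDl.

Definition fin_supp : {pred dprod A} :=
  fun f => `[< finite_set [set i | f i != 0] >].

Fact fin_supp_submod : submod_closed fin_supp.
Proof.
split=> [|a f g].
  rewrite unfold_in; apply/asboolP; apply: (sub_finite_set (B := set0)) => //.
  by move=> i /=; rewrite eqxx.
rewrite !unfold_in => /asboolP ff /asboolP fg; apply/asboolP.
apply: (sub_finite_set (B := ([set i | f i != 0%R] `|` [set i | g i != 0%R])%classic)).
  move=> i /= fgi; case: (eqVneq (f i) 0) => [f0|]; last by left.
  right; apply: contra fgi => /eqP g0.
  by rewrite -[X in X == _]/(a *: f i + g i) f0 g0 scaler0 addr0.
by rewrite finite_setU.
Qed.

HB.instance Definition _ :=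
  GRing.isSubmodClosed.Build R (dprod A) fin_supp fin_supp_submod.

Definition dsum : Type := {f : dprod A | fin_supp f}.
HB.instance Definition _ := SubChoice.on dsum.
HB.instance Definition _ := [SubChoice_isSubLmodule of dsum by <:].

Lemma dsum_ext (u v : dsum) : (forall i, val u i = val v i) -> u = v.
Proof. by move=> uv; apply/val_inj/functional_extensionality_dep. Qed.

Lemma dsum_supp (u : dsum) : finite_set [set i | val u i != 0].
Proof. exact/asboolP/(valP u). Qed.

Fact dsum_inj_subproof i (x : A i) :
  fin_supp (dfwith (fun j => 0 : A j) i x : dprod A).
Proof.
apply/asboolP; apply: (sub_finite_set (B := [set i]%classic)) => //.
by move=> j /=; case: dfwithP => // k _; rewrite eqxx.
Qed.

Definition dsum_inj i (x : A i) : dsum := exist (fun f => fin_supp f) _ (dsum_inj_subproof x).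
Arguments dsum_inj : clear implicits.

Fact dsum_inj_linear i : linear (dsum_inj i).
Proof.
move=> a x y; apply: dsum_ext => j.
rewrite -[RHS]/(a *: dfwith (fun j => 0 : A j) i x j
                + dfwith (fun j => 0 : A j) i y j) /=.
have [<-|ij] := eqVneq i j; first by rewrite !dfwithin.
by rewrite !dfwithout // scaler0 addr0.
Qed.

HB.instance Definition _ i :=
  GRing.isLinear.Build R (A i) dsum *:%R (dsum_inj i) (@dsum_inj_linear i).

Section Desc.
Variables (M : lmodType R) (phi : forall i, {linear A i -> M}).

Definition dsum_desc (u : dsum) : M := \sum_(i \in [set: I]) phi i (val u i).

Lemma dsum_descE (S : set I) (u : dsum) : finite_set S ->
  ([set i | val u i != 0%R] `<=` S)%classic ->
  dsum_desc u = \sum_(i \in S) phi i (val u i).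
Proof.
move=> fS uS; rewrite /dsum_desc; apply/esym/fsbig_widen => // i [_ /= nSi].
apply/eqP; apply: contrapT => phi0; apply: nSi; apply: uS => /=.
by apply/eqP => u0; apply: phi0; rewrite u0 linear0.
Qed.

Fact dsum_desc_linear : linear dsum_desc.
Proof.
move=> a u v.
pose S := ([set i | val u i != 0%R] `|` [set i | val v i != 0%R])%classic.
have fS : finite_set S by rewrite finite_setU; split; apply: dsum_supp.
rewrite (@dsum_descE S u) ?(@dsum_descE S v) ?(@dsum_descE S (a *: u + v)) //.
- rewrite !fsbig_finite // scaler_sumr -big_split /=.
  by apply: eq_bigr => i _; rewrite -linearP.
- move=> i /= uv; case: (eqVneq (val u i) 0) => [u0|]; last by left.
  right; apply: contra uv => /eqP v0.
  by rewrite -[X in X == _]/(a *: val u i + val v i) u0 v0 scaler0 addr0.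
- by move=> i; right.
- by move=> i; left.
Qed.

HB.instance Definition _ :=
  GRing.isLinear.Build R dsum M *:%R dsum_desc dsum_desc_linear.

Lemma dsum_desc_inj i (x : A i) : dsum_desc (dsum_inj i x) = phi i x.
Proof.
rewrite (@dsum_descE [set i]%classic) // ?fsbig_set1 /= ?dfwithin //.
by move=> j /=; case: dfwithP => // k _; rewrite eqxx.
Qed.

End Desc.
End DirectProduct.

Arguments dsum_inj {A} i x.

Lemma dsum_ind (A : I -> lmodType R) (M : lmodType R)
    (f g : {linear dsum A -> M}) :
  (forall i (x : A i), f (dsum_inj i x) = g (dsum_inj i x)) -> f =1 g.
Proof.
move=> fg u.
suff -> : u = \sum_(i \in [set i | val u i != 0]) dsum_inj i (val u i).
  rewrite fsbig_finite; last exact: dsum_supp.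
  by rewrite !linear_sum; apply: eq_bigr => i _; rewrite fg.
apply: dsum_ext => j; rewrite fsbig_finite; last exact: dsum_supp.
pose pj (w : dsum A) : A j := val w j.
have pjD : {morph pj : x y / x + y} by [].
have pj0 : pj 0 = 0 by [].
rewrite -[RHS]/(pj _) (big_morph pj pjD pj0).
have [uj0|uj0] := eqVneq (val u j) 0.
  rewrite uj0 big1_seq // => i /=; rewrite in_fset_set; last exact: dsum_supp.
  rewrite inE /= => ui0; rewrite /pj /= dfwithout //.
  by apply: contraNneq ui0 => ->; rewrite uj0.
rewrite (bigD1_seq j) ?fset_uniq //=; last first.
  by rewrite in_fset_set ?inE //; exact: dsum_supp.
rewrite {1}/pj /= dfwithin big1 ?addr0 // => i ij.
by rewrite /pj /= dfwithout.
Qed.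

Section Map.
Variables (A B : I -> lmodType R) (phi : forall i, {linear A i -> B i}).

Fact dsum_map_subproof (u : dsum A) :
  fin_supp (fun i => phi i (val u i) : B i).
Proof.
apply/asboolP; apply: sub_finite_set (dsum_supp u) => i /=.
by apply: contra => /eqP ->; rewrite linear0.
Qed.

Definition dsum_map (u : dsum A) : dsum B := exist (fun f => fin_supp f) _ (dsum_map_subproof u).

Fact dsum_map_linear : linear dsum_map.
Proof. by move=> a u v; apply: dsum_ext => i; apply: linearP. Qed.

HB.instance Definition _ :=
  GRing.isLinear.Build R (dsum A) (dsum B) *:%R dsum_map dsum_map_linear.

Lemma dsum_map_inj i (x : A i) : dsum_map (dsum_inj i x) = dsum_inj i (phi i x).
Proof.
apply: dsum_ext => j /=; have [<-|ij] := eqVneq i j; first by rewrite !dfwithin.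
by rewrite !dfwithout // linear0.
Qed.

End Map.
End DirectSum.

Arguments dsum_inj {R I A} i x.

(* X (x)_R Y: formal sums of pure tensors modulo the usual relations; formal   *)
(* negatives are not needed because - (x (x) y) = (- x) (x) y.                 *)
Inductive tens_rel (R : pzRingType) (X : lmodType R^c) (Y : lmodType R) :
    seq (X * Y) -> seq (X * Y) -> Prop :=
| TensRefl s : tens_rel s s
| TensSym s t : tens_rel s t -> tens_rel t s
| TensTrans s t u : tens_rel s t -> tens_rel t u -> tens_rel s u
| TensCat s s' t t' :
    tens_rel s s' -> tens_rel t t' -> tens_rel (s ++ t) (s' ++ t')
| TensComm s t : tens_rel (s ++ t) (t ++ s)
| TensZero y : tens_rel [:: (0, y)] [::]
| TensAddl x x' y : tens_rel [:: (x + x', y)] [:: (x, y); (x', y)]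
| TensAddr x y y' : tens_rel [:: (x, y + y')] [:: (x, y); (x, y')]
| TensBalanced x (r : R) y : tens_rel [:: ((r : R^c) *: x, y)] [:: (x, r *: y)].

Section Tensor.
Variables (R : pzRingType) (X : lmodType R^c) (Y : lmodType R).
Implicit Types s t : seq (X * Y).

Definition tens_eq : rel (seq (X * Y)) := fun s t => `[< tens_rel s t >].

Fact tens_eq_refl : reflexive tens_eq.
Proof. by move=> s; apply/asboolP/TensRefl. Qed.
Fact tens_eq_sym : symmetric tens_eq.
Proof. by move=> s t; apply/asboolP/asboolP; apply: TensSym. Qed.
Fact tens_eq_trans : transitive tens_eq.
Proof. by move=> t s u /asboolP st /asboolP tu; apply/asboolP/(TensTrans st). Qed.

Canonical tens_equiv := EquivRel tens_eq tens_eq_refl tens_eq_sym tens_eq_trans.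

Definition tens : Type := {eq_quot tens_equiv}.
HB.instance Definition _ := Choice.on tens.

Definition tens_pi s : tens := \pi_{eq_quot tens_equiv} s.
Definition tens_repr (u : tens) : seq (X * Y) := repr (u : {eq_quot tens_equiv}).

Lemma tens_reprK u : tens_pi (tens_repr u) = u.
Proof. exact: reprK. Qed.

Lemma tens_piP s t : tens_pi s = tens_pi t <-> tens_rel s t.
Proof.
split=> [/eqP|st]; first by rewrite eqmodE => /asboolP.
by apply/eqP; rewrite eqmodE; apply/asboolP.
Qed.

Lemma tens_repr_pi s : tens_rel (tens_repr (tens_pi s)) s.
Proof. by apply/tens_piP; rewrite tens_reprK. Qed.

Let add u v : tens := tens_pi (tens_repr u ++ tens_repr v).
Let zero : tens := tens_pi [::].
Let opp_word s := [seq (- p.1, p.2) | p <- s].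
Let opp u : tens := tens_pi (opp_word (tens_repr u)).

Let add_pi s t : add (tens_pi s) (tens_pi t) = tens_pi (s ++ t).
Proof. by apply/tens_piP/TensCat; apply: tens_repr_pi. Qed.

Let addA : associative add.
Proof.
move=> u v w; rewrite -(tens_reprK u) -(tens_reprK v) -(tens_reprK w).
by rewrite !add_pi catA.
Qed.
Let addC : commutative add.
Proof. by move=> u v; apply/tens_piP/TensComm. Qed.
Let add0 : left_id zero add.
Proof. by move=> u; rewrite -(tens_reprK u) add_pi. Qed.
Let addN : left_inverse zero opp add.
Proof.
move=> u; rewrite -{2}(tens_reprK u) add_pi; apply/tens_piP.
elim: (tens_repr u) => [|[x y] s IHs] /=; first exact: TensRefl.
apply: (@TensTrans _ _ _ _ ([:: (- x, y); (x, y)] ++ (opp_word s ++ s))).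
  rewrite -[X in tens_rel X]cat1s -[X in tens_rel _ X]/([:: (- x, y)] ++ _).
  apply: TensCat; first exact: TensRefl.
  rewrite -cat1s catA -[X in tens_rel _ X]/([:: (x, y)] ++ _) catA.
  by apply: TensCat; [apply: TensComm|apply: TensRefl].
rewrite -[X in tens_rel _ X]/([::] ++ [::]); apply: TensCat => //.
apply: TensTrans (TensZero _ y); apply: TensSym.
by rewrite -(addNr x); apply: TensAddl.
Qed.

HB.instance Definition _ := GRing.isZmodule.Build tens addA addC add0 addN.
HB.instance Definition _ := GRing.Zmodule_isLmodule.Build int tens
  (@mulrzA_C tens) (@mulr1z tens) (@mulrzDl tens) (@mulrzDr tens).

Lemma tens_pi_cat s t : tens_pi (s ++ t) = tens_pi s + tens_pi t.
Proof. by rewrite -add_pi. Qed.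

Lemma tens_pi_nil : tens_pi [::] = 0.
Proof. by []. Qed.

Definition tmul (x : X) (y : Y) : tens := tens_pi [:: (x, y)].

Lemma tmulDl x x' y : tmul (x + x') y = tmul x y + tmul x' y.
Proof. by rewrite -tens_pi_cat; apply/tens_piP/TensAddl. Qed.

Lemma tmulDr x y y' : tmul x (y + y') = tmul x y + tmul x y'.
Proof. by rewrite -tens_pi_cat; apply/tens_piP/TensAddr. Qed.

Lemma tmul_balanced x (r : R) y : tmul ((r : R^c) *: x) y = tmul x (r *: y).
Proof. exact/tens_piP/TensBalanced. Qed.

Lemma tmul0r y : tmul 0 y = 0.
Proof. exact/tens_piP/TensZero. Qed.

Lemma tmulr0 x : tmul x 0 = 0.
Proof. by rewrite -(scale0r 0) -tmul_balanced scale0r tmul0r. Qed.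

Lemma tens_sum (u : tens) : u = \sum_(p <- tens_repr u) tmul p.1 p.2.
Proof.
rewrite -{1}(tens_reprK u); elim: (tens_repr u) => [|[x y] s IHs].
  by rewrite big_nil.
by rewrite big_cons -cat1s tens_pi_cat IHs.
Qed.

Lemma tens_ext (M : lmodType int) (f g : {linear tens -> M}) :
  (forall x y, f (tmul x y) = g (tmul x y)) -> f =1 g.
Proof.
by move=> fg u; rewrite (tens_sum u) !linear_sum; apply: eq_bigr => p _.
Qed.

End Tensor.

Section TensorMap.
Variables (R : pzRingType) (X X' : lmodType R^c) (Y Y' : lmodType R).
Variables (f : {linear X -> X'}) (g : {linear Y -> Y'}).

Definition tens_map (u : tens X Y) : tens X' Y' :=
  \sum_(p <- tens_repr u) tmul (f p.1) (g p.2).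

Lemma tens_map_pi s :
  tens_map (tens_pi s) = \sum_(p <- s) tmul (f p.1) (g p.2).
Proof.
have rel_sum t t' : tens_rel t t' ->
    \sum_(p <- t) tmul (f p.1) (g p.2) = \sum_(p <- t') tmul (f p.1) (g p.2).
  elim=> {t t'} // [t t' t'' _ -> _ ->|t t1 t' t1' _ IHt _ IHt'|t t'|y|x x' y
      |x y y'|x r y] //=.
  - by rewrite !big_cat /= IHt IHt'.
  - by rewrite !big_cat /= addrC.
  - by rewrite big_cons !big_nil /= linear0 tmul0r addr0.
  - by rewrite !big_cons !big_nil /= !addr0 linearD tmulDl.
  - by rewrite !big_cons !big_nil /= !addr0 linearD tmulDr.
  - by rewrite !big_cons !big_nil /= !addr0 !linearZ /= tmul_balanced.
exact/rel_sum/tens_repr_pi.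
Qed.

Fact tens_map_zmod_morphism : zmod_morphism tens_map.
Proof.
have tD u v : tens_map (u + v) = tens_map u + tens_map v.
  rewrite -(tens_reprK u) -(tens_reprK v) -tens_pi_cat !tens_map_pi.
  by rewrite big_cat.
by move=> u v; apply: (addIr (tens_map v)); rewrite -tD !subrK.
Qed.

HB.instance Definition _ := GRing.isZmodMorphism.Build
  (tens X Y) (tens X' Y') tens_map tens_map_zmod_morphism.

Fact tens_map_scalable : scalable tens_map.
Proof. by move=> n u; apply: raddfMz. Qed.

HB.instance Definition _ := GRing.isScalable.Build int
  (tens X Y) (tens X' Y') *:%R tens_map tens_map_scalable.

Lemma tens_map_tmul x y : tens_map (tmul x y) = tmul (f x) (g y).
Proof. by rewrite tens_map_pi big_cons big_nil addr0. Qed.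

End TensorMap.

Section Complexes.
Variable R : pzRingType.

Record complex := Complex {
  cobj :> int -> lmodType R;
  cdiff : forall m, {linear cobj m -> cobj (m - 1)};
  cdiffK : forall m (x : cobj m), cdiff (m - 1) (cdiff m x) = 0
}.

Record chain_map (X Y : complex) := ChainMap {
  cmap :> forall m, {linear X m -> Y m};
  cmap_diff : forall m (x : X m),
    cmap (m - 1) (cdiff X m x) = cdiff Y m (cmap m x)
}.

(* Exactness at degree m - 1; all degrees are of this form. *)
Definition exact_complex (X : complex) : Prop :=
  forall m, exact_at (cdiff X m) (cdiff X (m - 1)).

Definition cycles (X : complex) (m : int) : lmodType R := kernel (cdiff X m).

(* Isomorphisms and exactness in the category of complexes are degreewise. *)
Definition isomorphic_complex (X Y : complex) : Prop :=
  exists f : chain_map X Y, forall m, bijective (f m).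

Definition short_exact_complex (X Y Z : complex)
    (f : chain_map X Y) (g : chain_map Y Z) : Prop :=
  forall m, short_exact (f m) (g m).

Section Sphere.
Variables (m : int) (M : lmodType R).

Definition sphere_obj (n : int) : lmodType R := if n == m then M else 'rV[R]_0.

Definition sphere_diff (n : int) :
  {linear sphere_obj n -> sphere_obj (n - 1)} := \0.

Fact sphere_diffK n (x : sphere_obj n) :
  sphere_diff (n - 1) (sphere_diff n x) = 0.
Proof. by []. Qed.

Definition sphere : complex := Complex sphere_diffK.

End Sphere.

Section DirectSumComplex.
Variables (I : choiceType) (X : I -> complex).

Definition dsum_diff (n : int) :
    {linear dsum (fun i => X i n) -> dsum (fun i => X i (n - 1))} :=
  dsum_map (fun i => cdiff (X i) n).

Fact dsum_diffK n (u : dsum (fun i => X i n)) :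
  dsum_diff (n - 1) (dsum_diff n u) = 0.
Proof. by apply: dsum_ext => i /=; apply: cdiffK. Qed.

Definition dsum_complex : complex := Complex dsum_diffK.

End DirectSumComplex.

(* Objects of Ch(Ch(R)). *)
Record complex2 := Complex2 {
  c2obj :> int -> complex;
  c2diff : forall k, chain_map (c2obj k) (c2obj (k - 1));
  c2diffK : forall k m (x : c2obj k m), c2diff (k - 1) m (c2diff k m x) = 0
}.

Definition exact_complex2 (F : complex2) : Prop :=
  forall k m, exact_at (c2diff F k m) (c2diff F (k - 1) m).

Section Cycles2.
Variables (F : complex2) (k : int).

Definition cycles2_obj (m : int) : lmodType R := kernel (c2diff F k m).

Fact cycles2_diff_subproof m (x : cycles2_obj m) :
  ker_pred (c2diff F k (m - 1)) (cdiff (F k) m (val x)).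
Proof.
by rewrite /ker_pred cmap_diff; case: x => x /= /eqP ->; rewrite linear0.
Qed.

Definition cycles2_diff_fun m (x : cycles2_obj m) : cycles2_obj (m - 1) :=
  exist (fun y => ker_pred _ y) _ (cycles2_diff_subproof x).

Fact cycles2_diff_linear m : linear (@cycles2_diff_fun m).
Proof. by move=> a x y; apply: val_inj; apply: linearP. Qed.

HB.instance Definition _ m := GRing.isLinear.Build R
  (cycles2_obj m) (cycles2_obj (m - 1)) *:%R
  (@cycles2_diff_fun m) (@cycles2_diff_linear m).

Definition cycles2_diff m : {linear cycles2_obj m -> cycles2_obj (m - 1)} :=
  @cycles2_diff_fun m.

Fact cycles2_diffK m (x : cycles2_obj m) :
  cycles2_diff (m - 1) (cycles2_diff m x) = 0.
Proof. by apply: val_inj; apply: cdiffK. Qed.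

Definition cycles2 : complex := Complex cycles2_diffK.

End Cycles2.
End Complexes.

Definition id_chain_map (R : pzRingType) (X : complex R) : chain_map X X :=
  @ChainMap R X X (fun=> idfun) (fun _ _ => erefl).

(* (X (x) Y)_m is the direct sum of X_p (x) Y_q over the pairs (p, q) with     *)
(* p + q = m.                                                                  *)
Definition bidegree (m : int) : Type := {pq : int * int | pq.1 + pq.2 == m}.
HB.instance Definition _ m := SubChoice.on (bidegree m).

Fact bidegree_predl m (k : bidegree m) :
  ((val k).1 - 1, (val k).2).1 + ((val k).1 - 1, (val k).2).2 == m - 1.
Proof. by case: k => -[p q] /= /eqP <-; rewrite addrAC. Qed.

Fact bidegree_predr m (k : bidegree m) :
  ((val k).1, (val k).2 - 1).1 + ((val k).1, (val k).2 - 1).2 == m - 1.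
Proof. by case: k => -[p q] /= /eqP <-; rewrite addrA. Qed.

Definition predl m (k : bidegree m) : bidegree (m - 1) :=
  exist (fun pq : int * int => pq.1 + pq.2 == m - 1) _ (bidegree_predl k).
Definition predr m (k : bidegree m) : bidegree (m - 1) :=
  exist (fun pq : int * int => pq.1 + pq.2 == m - 1) _ (bidegree_predr k).

Section TensorComplex.
Variables (R : pzRingType) (X : complex R^c) (Y : complex R).

Definition tens_summand m (k : bidegree m) : lmodType int :=
  tens (X (val k).1) (Y (val k).2).

Definition tens_obj (m : int) : lmodType int := dsum (@tens_summand m).

Definition tens_diffl m (k : bidegree m) :
    {linear tens_summand k -> tens_summand (predl k)} :=
  tens_map (cdiff X (val k).1) idfun.

Definition tens_diffr m (k : bidegree m) :
    {linear tens_summand k -> tens_summand (predr k)} :=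
  tens_map idfun (cdiff Y (val k).2).

Definition tens_diff_summand m (k : bidegree m) :
    {linear tens_summand k -> tens_obj (m - 1)} :=
  (dsum_inj (predl k) \o tens_diffl k)
  \+ (((-1) ^ (val k).1) \*: (dsum_inj (predr k) \o tens_diffr k)).

Definition tens_diff m : {linear tens_obj m -> tens_obj (m - 1)} :=
  dsum_desc (@tens_diff_summand m).

Lemma tens_diff_tmul m (k : bidegree m) (x : X (val k).1) (y : Y (val k).2) :
  tens_diff m (dsum_inj k (tmul x y : tens_summand k)) =
    dsum_inj (predl k) (tmul (cdiff X _ x) y : tens_summand (predl k)) +
    ((-1) ^ (val k).1) *:
      dsum_inj (predr k) (tmul x (cdiff Y _ y) : tens_summand (predr k)).
Proof.
by rewrite /tens_diff /= dsum_desc_inj /= /tens_diffl /tens_diffr !tens_map_tmul.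
Qed.

Lemma tens_obj_ext m (M : lmodType int) (f g : {linear tens_obj m -> M}) :
  (forall k (x : X (val k).1) (y : Y (val k).2),
    f (dsum_inj k (tmul x y : tens_summand k)) =
    g (dsum_inj k (tmul x y : tens_summand k))) -> f =1 g.
Proof.
move=> fg; apply: dsum_ind => k u.
pose fk : {linear tens_summand k -> M} := f \o dsum_inj k.
pose gk : {linear tens_summand k -> M} := g \o dsum_inj k.
exact: (@tens_ext _ _ _ _ fk gk (fg k) u).
Qed.

Fact tens_summand_irrelevance m p q (h h' : (p, q).1 + (p, q).2 == m)
    (t : tens (X p) (Y q)) :
  dsum_inj (exist _ (p, q) h : bidegree m)
           (t : tens_summand (exist _ (p, q) h : bidegree m)) =
  dsum_inj (exist _ (p, q) h' : bidegree m)
           (t : tens_summand (exist _ (p, q) h' : bidegree m)).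
Proof. by rewrite (bool_irrelevance h h'). Qed.

Fact tens_diffK m (u : tens_obj m) : tens_diff (m - 1) (tens_diff m u) = 0.
Proof.
apply: (@tens_obj_ext m _ (tens_diff (m - 1) \o tens_diff m) \0) => k x y /=.
rewrite tens_diff_tmul linearD linearZ /= !tens_diff_tmul !cdiffK.
rewrite tmul0r tmulr0 !linear0 add0r addr0.
rewrite (_ : dsum_inj (predr (predl k)) _ =
  dsum_inj (predl (predr k)) (tmul (cdiff X _ x) (cdiff Y _ y)));
  last exact: tens_summand_irrelevance.
by rewrite -scalerDl /= exprzDr ?unitrN1 // mulrN1 addNr scale0r.
Qed.

Definition tens_complex : complex int := Complex tens_diffK.

End TensorComplex.

Section TensorComplexMap.
Variables (R : pzRingType) (X X' : complex R^c) (Y Y' : complex R).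
Variables (f : chain_map X X') (g : chain_map Y Y').

Definition tens_summand_map m (k : bidegree m) :
    {linear tens_summand X Y k -> tens_summand X' Y' k} :=
  tens_map (f (val k).1) (g (val k).2).

Definition tens_obj_map m : {linear tens_obj X Y m -> tens_obj X' Y' m} :=
  dsum_map (@tens_summand_map m).

Lemma tens_obj_map_tmul m (k : bidegree m) (x : X (val k).1) (y : Y (val k).2) :
  tens_obj_map m (dsum_inj k (tmul x y : tens_summand X Y k)) =
    dsum_inj k (tmul (f _ x) (g _ y) : tens_summand X' Y' k).
Proof. by rewrite /tens_obj_map /= dsum_map_inj /= /tens_summand_map tens_map_tmul. Qed.

Fact tens_obj_map_diff m (u : tens_obj X Y m) :
  tens_obj_map (m - 1) (tens_diff X Y m u) = tens_diff X' Y' m (tens_obj_map m u).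
Proof.
apply: (@tens_obj_ext _ _ _ m _ (tens_obj_map (m - 1) \o tens_diff X Y m)
  (tens_diff X' Y' m \o tens_obj_map m)) => k x y /=.
rewrite tens_obj_map_tmul !tens_diff_tmul linearD linearZ /= !tens_obj_map_tmul.
by rewrite !cmap_diff.
Qed.

Definition tens_chain_map : chain_map (tens_complex X Y) (tens_complex X' Y') :=
  @ChainMap _ (tens_complex X Y) (tens_complex X' Y')
    tens_obj_map tens_obj_map_diff.

End TensorComplexMap.

Section TensorModComplex.
Variables (R : pzRingType) (N : lmodType R^c) (F : complex R).

Definition tens_mod_diff m : {linear tens N (F m) -> tens N (F (m - 1))} :=
  tens_map idfun (cdiff F m).

Fact tens_mod_diffK m (u : tens N (F m)) :
  tens_mod_diff (m - 1) (tens_mod_diff m u) = 0.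
Proof.
apply: (@tens_ext _ _ _ _ (tens_mod_diff (m - 1) \o tens_mod_diff m) \0) => x y /=.
by rewrite /tens_mod_diff !tens_map_tmul /= cdiffK tmulr0.
Qed.

Definition tens_mod_complex : complex int := Complex tens_mod_diffK.

End TensorModComplex.

Section TensorComplex2.
Variables (R : pzRingType) (X : complex R^c) (F : complex2 R).

Definition tens_complex2_diff k :
    chain_map (tens_complex X (F k)) (tens_complex X (F (k - 1))) :=
  tens_chain_map (id_chain_map X) (c2diff F k).

Fact tens_complex2_diffK k m (u : tens_complex X (F k) m) :
  tens_complex2_diff (k - 1) m (tens_complex2_diff k m u) = 0.
Proof.
apply: (@tens_obj_ext _ X (F k) m _
  (tens_complex2_diff (k - 1) m \o tens_complex2_diff k m) \0) => i x y /=.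
by rewrite !tens_obj_map_tmul /= c2diffK tmulr0 linear0.
Qed.

Definition tens_complex2 : complex2 int := Complex2 tens_complex2_diffK.

End TensorComplex2.

Definition flat (R : pzRingType) (M : lmodType R) : Prop :=
  forall (U V W : lmodType R^c) (f : {linear U -> V}) (g : {linear V -> W}),
    short_exact f g ->
    short_exact (tens_map f (idfun : {linear M -> M}))
                (tens_map g (idfun : {linear M -> M})).

Definition tens_flat (R : pzRingType) (L : complex R) : Prop :=
  forall (X Y Z : complex R^c) (f : chain_map X Y) (g : chain_map Y Z),
    short_exact_complex f g ->
    short_exact_complex (tens_chain_map f (id_chain_map L))
                        (tens_chain_map g (id_chain_map L)).

(* "M = Z_0(F)" is read up to isomorphism, here and for complexes. *)
Definition gorenstein_flat (R : pzRingType) (B : lmodType R^c -> Prop)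
    (M : lmodType R) : Prop :=
  exists F : complex R,
    [/\ exact_complex F,
        forall m, flat (F m),
        forall N, B N -> exact_complex (tens_mod_complex N F)
      & isomorphic M (cycles F 0)].

Definition gorenstein_flat_complex (R : pzRingType) (B : complex R^c -> Prop)
    (X : complex R) : Prop :=
  exists F : complex2 R,
    [/\ exact_complex2 F,
        forall k, tens_flat (F k),
        forall N, B N -> exact_complex2 (tens_complex2 N F)
      & isomorphic_complex X (cycles2 F 0)].

(* Ch(G), for a class G of modules. *)
Definition Ch_class (R : pzRingType) (G : lmodType R -> Prop)
    (X : complex R) : Prop :=
  forall m, G (X m).

Definition sum_of_spheres (R : pzRingType) (B : lmodType R -> Prop)
    (X : complex R) : Prop :=
  exists N : int -> lmodType R, (forall m, B (N m)) /\
    isomorphic_complex X (dsum_complex (fun m => sphere m (N m))).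

(* Main.v *)
(** Everything is detected degreewise: a complex is tensor-flat iff its components
are flat, and tensoring with a sum of spheres on modules of [B] is exact iff
tensoring each row with these modules is.  So the forward direction reads off the
rows of [F], testing against complexes with zero differential.  Conversely, let all
[X_m] be Gorenstein flat, with short exact sequences [K_m -> P_m -> X_m] and
[X_m -> Q_m -> C_m] that stay exact under [N (x) -].  Then [X] is a quotient of the
complex with components [P_m * P_(m+1)] and a subcomplex of that with components
[Q_m * Q_(m-1)].  The kernel and the cokernel have components which are extensions of
[P_(m+1)] by [K_m] and of [C_m] by [Q_(m-1)], hence Gorenstein flat; so both
constructions can be iterated, and splicing yields the resolution of [X]. *)

From HB Require Import structures.
Require Import Defs.
From mathcomp Require Import all_boot all_order all_algebra.
From mathcomp Require Import all_classical.
Set Implicit Arguments.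
Unset Strict Implicit.
Unset Printing Implicit Defensive.
Import GRing.Theory.
Local Open Scope ring_scope.
Local Open Scope quotient_scope.

(** Records holding a module and maps live in [Type]; their existence is asserted through
    [inhabited], and this choice turns it back into data. *)
Lemma inhabited_witness (T : Type) : inhabited T -> T.
Proof. by move=> hT; have [] : {x : T | True} by apply: cid; case: hT => x; exists x. Qed.

(** * Linear maps and cokernels *)

Section LinearMaps.
Variable R : pzRingType.
Implicit Types U V W : lmodType R.

Lemma linear_ex U V (h : U -> V) : linear h -> exists h' : {linear U -> V}, h' =1 h.
Proof.
move=> hl; pose m := GRing.isLinear.Build R U V *:%R h hl.
by exists (HB.pack h m : {linear U -> V}).
Qed.

(** Preimages under an injective map are unique, so choosing them is automatically linear. *)
Lemma lift_mono U V W (i : {linear U -> V}) (h : {linear W -> V}) :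
  injective i -> (forall w, exists u, i u = h w) ->
  exists k : {linear W -> U}, forall w, i (k w) = h w.
Proof.
move=> i_inj /choice[k ik].
have kl : linear k by move=> a x y; apply: i_inj; rewrite linearP !ik linearP.
by have [k' k'E] := linear_ex kl; exists k' => w; rewrite k'E.
Qed.

(** A chosen section [s] of [p] need not be linear, but [h \o s] is, because [h] vanishes on the
    kernel of [p]. *)
Lemma lift_epi U V W (p : {linear U -> V}) (h : {linear U -> W}) :
  (forall v, exists u, p u = v) -> (forall u, p u = 0 -> h u = 0) ->
  exists k : {linear V -> W}, forall u, k (p u) = h u.
Proof.
move=> /choice[s ps] ph.
have hs u : h (s (p u)) = h u.
  by apply/eqP; rewrite -subr_eq0 -linearB ph ?eqxx // linearB ps subrr.
have kl : linear (h \o s).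
  move=> a x y /=; rewrite -linearP -[RHS]hs; congr (h (s _)).
  by rewrite linearP !ps.
by have [k' k'E] := linear_ex kl; exists k' => u; rewrite k'E /= hs.
Qed.

Lemma linear_injP U V (f : {linear U -> V}) :
  (forall x, f x = 0 -> x = 0) -> injective f.
Proof.
move=> f0 x y fxy; apply/eqP; rewrite -subr_eq0.
by apply/eqP/f0; rewrite linearB fxy subrr.
Qed.

Lemma isomorphic_inv U V : isomorphic U V ->
  exists (f : {linear U -> V}) (g : {linear V -> U}), cancel f g /\ cancel g f.
Proof.
case=> f [g fK gK].
have gl : linear g by move=> a x y; rewrite -{1}(gK x) -{1}(gK y) -linearP fK.
have [g' g'E] := linear_ex gl.
by exists f, g'; split=> x; rewrite g'E.
Qed.

Section Cokernel.
Variables (U V : lmodType R) (f : {linear U -> V}).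

Definition image_pred : {pred V} := fun v => `[< exists u, f u = v >].

Fact image_pred_zmod : zmod_closed image_pred.
Proof.
split=> [|x y]; first by apply/asboolP; exists 0; rewrite linear0.
by move=> /asboolP[u <-] /asboolP[v <-]; apply/asboolP; exists (u - v); rewrite linearB.
Qed.

HB.instance Definition _ :=
  GRing.isZmodClosed.Build V image_pred image_pred_zmod.

(** The quotient is formed as abelian groups; scalars then act on representatives, which is well
    defined because [f] is linear. *)
Definition coker : Type := Quotient.quot image_pred.
HB.instance Definition _ := GRing.Zmodule.on coker.

Definition coker_pi (v : V) : coker := \pi_(Quotient.quot image_pred) v.
Definition coker_repr (u : coker) : V := repr (u : Quotient.quot image_pred).

Lemma coker_reprK u : coker_pi (coker_repr u) = u.
Proof. exact: reprK. Qed.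

Lemma coker_piP x y : coker_pi x = coker_pi y <-> exists u, f u = x - y.
Proof.
split=> [/eqP|fu]; first by rewrite -Quotient.idealrBE => /asboolP.
by apply/eqP; rewrite -Quotient.idealrBE; apply/asboolP.
Qed.

Lemma coker_piD x y : coker_pi (x + y) = coker_pi x + coker_pi y.
Proof. exact: raddfD. Qed.

Let scale (a : R) (u : coker) : coker := coker_pi (a *: coker_repr u).

Let scale_pi a x : scale a (coker_pi x) = coker_pi (a *: x).
Proof.
have /coker_piP[u fu] := coker_reprK (coker_pi x).
by apply/coker_piP; exists (a *: u); rewrite linearZ_LR fu scalerBr.
Qed.

Let scaleA a b u : scale a (scale b u) = scale (a * b) u.
Proof. by rewrite -(coker_reprK u) !scale_pi scalerA. Qed.
Let scale1 : left_id 1 scale.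
Proof. by move=> u; rewrite -(coker_reprK u) scale_pi scale1r. Qed.
Let scaleDr : right_distributive scale +%R.
Proof.
move=> a u v; rewrite -(coker_reprK u) -(coker_reprK v).
by rewrite -coker_piD !scale_pi scalerDr coker_piD.
Qed.
Let scaleDl u : {morph scale^~ u : a b / a + b}.
Proof. by move=> a b; rewrite -(coker_reprK u) !scale_pi scalerDl coker_piD. Qed.

HB.instance Definition _ :=
  GRing.Zmodule_isLmodule.Build R coker scaleA scale1 scaleDr scaleDl.

Fact coker_pi_linear : linear coker_pi.
Proof. by move=> a x y; rewrite coker_piD -scale_pi. Qed.

HB.instance Definition _ :=
  GRing.isLinear.Build R V coker *:%R coker_pi coker_pi_linear.

Lemma coker_pi_exact : exact_at f coker_pi.
Proof.
move=> v; rewrite -(linear0 coker_pi).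
by split=> [/coker_piP|[u fu]]; [|apply/coker_piP; exists u]; rewrite subr0.
Qed.

End Cokernel.

Section Pairing.
Variables (U V W : lmodType R) (f : {linear W -> U}) (g : {linear W -> V}).

Definition pairing (w : W) : U * V := (f w, g w).

Fact pairing_linear : linear pairing.
Proof. by move=> a x y; congr pair; apply: linearP. Qed.

HB.instance Definition _ :=
  GRing.isLinear.Build R W (U * V)%type *:%R pairing pairing_linear.
End Pairing.

(** As [p] is onto, [h] and [i] have the same image; as [i'] is injective, [h'] and [p'] have the
    same kernel. *)
Lemma splice_exact (A A' B B' C : lmodType R) (p : {linear A -> A'}) (i : {linear A' -> B})
    (p' : {linear B -> B'}) (i' : {linear B' -> C})
    (h : {linear A -> B}) (h' : {linear B -> C}) :
  (forall z, exists y, p y = z) -> exact_at i p' -> injective i' ->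
  h =1 i \o p -> h' =1 i' \o p' -> exact_at h h'.
Proof.
move=> p_epi ip' i'_inj hE h'E y; rewrite h'E /=; split=> [ip'0|[x <-]].
  have /ip'[z <-] : p' y = 0 by apply: i'_inj; rewrite ip'0 linear0.
  by have [x <-] := p_epi z; exists x; rewrite hE.
suff -> : p' (h x) = 0 by rewrite linear0.
by apply/ip'; exists (p x); rewrite hE.
Qed.

Lemma kernel_ex U V (f : {linear U -> V}) :
  exists (K : lmodType R) (i : {linear K -> U}), injective i /\ exact_at i f.
Proof.
exists (kernel f), val; split=> [|y]; first exact: val_inj.
split=> [fy|[x <-]]; last by apply/eqP; case: x.
have yP : ker_pred f y by apply/eqP.
by exists (exist (fun x => ker_pred _ x) _ yP).
Qed.

Lemma coker_ex U V (f : {linear U -> V}) :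
  exists (C : lmodType R) (p : {linear V -> C}),
    exact_at f p /\ forall z, exists y, p y = z.
Proof.
exists (coker f), (@coker_pi _ _ f); split; first exact: coker_pi_exact.
by move=> z; exists (coker_repr z); apply: coker_reprK.
Qed.

Section Retract.
Variables (A B C A' B' C' : lmodType R).
Variables (f : {linear A -> B}) (g : {linear B -> C}).
Variables (f' : {linear A' -> B'}) (g' : {linear B' -> C'}).
Variables (sA : {linear A -> A'}) (rA : {linear A' -> A}).
Variables (sB : {linear B -> B'}) (rB : {linear B' -> B}).
Variables (sC : {linear C -> C'}) (rC : {linear C' -> C}).
Hypotheses (sBK : cancel sB rB) (sCK : cancel sC rC).
Hypotheses (sf : forall x, sB (f x) = f' (sA x)) (rf : forall x, rB (f' x) = f (rA x)).
Hypotheses (sg : forall x, sC (g x) = g' (sB x)).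

(** A preimage of [sB y] in the primed row is carried back by [rA]. This transports exactness along
    isomorphic tensor factors. *)
Lemma exact_at_retract : exact_at f' g' -> exact_at f g.
Proof.
move=> fg' y; split=> [gy|[x <-]].
  have /fg'[x fx] : g' (sB y) = 0 by rewrite -sg gy linear0.
  by exists (rA x); rewrite -rf fx sBK.
by rewrite -[LHS]sCK sg sf (_ : g' _ = 0) ?linear0 //; apply/fg'; exists (sA x).
Qed.
End Retract.

End LinearMaps.

(** * Direct sums *)

Section DirectSums.
Variables (R : pzRingType) (I : choiceType).
Variables (A A' A'' : I -> lmodType R).
Variables (phi : forall i, {linear A i -> A' i}) (psi : forall i, {linear A' i -> A'' i}).

(** Choosing the preimage 0 wherever [u] has component 0 keeps the chosen family finitely
    supported. *)
Lemma dsum_lift (u : dsum A') :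
  (forall i, exists x, phi i x = val u i) -> exists v, dsum_map phi v = u.
Proof.
move=> H.
have {}H i : exists x, phi i x = val u i /\ (val u i = 0 -> x = 0).
  have [ui0|ui0] := eqVneq (val u i) 0; first by exists 0; rewrite linear0.
  by have [x ux] := H i; exists x; split=> // /eqP; rewrite (negPf ui0).
pose x i := projT1 (cid (H i)).
have xP i : phi i (x i) = val u i /\ (val u i = 0 -> x i = 0) := projT2 (cid (H i)).
have fx : fin_supp (x : dprod A).
  apply/asboolP; apply: sub_finite_set (dsum_supp u) => i /=.
  by apply: contra => /eqP/(xP i).2 ->.
exists (exist (fun f => fin_supp f) _ fx : dsum A).
by apply: dsum_ext => i; rewrite -[LHS]/(phi i (x i)) (xP i).1.
Qed.

Lemma dsum_map_surj : (forall z, exists y, dsum_map phi y = z) <->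
  forall i z, exists y, phi i y = z.
Proof.
split=> [H i z|H z]; last exact: dsum_lift.
have [y yz] := H (dsum_inj i z); exists (val y i).
by rewrite -[LHS]/(val (dsum_map phi y) i) yz /= dfwithin.
Qed.

Lemma dsum_map_injective : injective (dsum_map phi) <-> forall i, injective (phi i).
Proof.
split=> [H i|H u v uv]; last first.
  by apply: dsum_ext => i; apply: H; apply: (congr1 (fun w => val w i) uv).
apply: linear_injP => x phx.
have /(congr1 (fun w => val w i)) : dsum_inj i x = 0 :> dsum A.
  by apply: H; rewrite dsum_map_inj phx !linear0.
by rewrite /= dfwithin.
Qed.

Lemma dsum_map_exact : exact_at (dsum_map phi) (dsum_map psi) <->
  forall i, exact_at (phi i) (psi i).
Proof.
split=> [H i y|H u].
  split=> [psi0|[x <-]].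
    have /H[x xy] : dsum_map psi (dsum_inj i y) = 0 by rewrite dsum_map_inj psi0 linear0.
    by exists (val x i); rewrite -[LHS]/(val (dsum_map phi x) i) xy /= dfwithin.
  have /(congr1 (fun w => val w i)) : dsum_map psi (dsum_map phi (dsum_inj i x)) = 0.
    by apply/H; exists (dsum_inj i x).
  by rewrite /= dfwithin.
split=> [pu|[v <-]].
  apply: dsum_lift => i; apply/H.
  exact: (congr1 (fun w => val w i) pu).
by apply: dsum_ext => i; apply/H; exists (val v i).
Qed.

End DirectSums.

(** Components of a tensor product complex are direct sums over bidegrees, so this reduces flatness
    of a complex to single bidegrees. *)
Lemma dsum_map_short_exact (R : pzRingType) (I : choiceType)
    (A A' A'' : I -> lmodType R) (phi : forall i, {linear A i -> A' i})
    (psi : forall i, {linear A' i -> A'' i}) :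
  short_exact (dsum_map phi) (dsum_map psi) <->
    forall i, short_exact (phi i) (psi i).
Proof.
split=> [[phi_inj phi_psi psi_epi] i|H].
  split; [exact: (dsum_map_injective _).1|exact: (dsum_map_exact _ _).1|].
  exact: (dsum_map_surj _).1.
split; [apply/dsum_map_injective|apply/dsum_map_exact|apply/dsum_map_surj];
  by move=> i; case: (H i).
Qed.

(** * Right exactness of the tensor product *)

Section TensorMaps.
Variable R : pzRingType.
Implicit Types (N : lmodType R^c) (U V W : lmodType R).

Lemma tens_map_comp N N' N'' U V W (f : {linear N -> N'}) (f' : {linear N' -> N''})
    (g : {linear U -> V}) (g' : {linear V -> W}) (h : {linear N -> N''})
    (k : {linear U -> W}) :
  h =1 f' \o f -> k =1 g' \o g ->
  forall u, tens_map h k u = tens_map f' g' (tens_map f g u).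
Proof.
move=> hE kE u.
apply: (@tens_ext _ _ _ _ (tens_map h k) (tens_map f' g' \o tens_map f g)) => x y /=.
by rewrite !tens_map_tmul hE kE.
Qed.

Lemma tens_map_id N U (f : {linear N -> N}) (g : {linear U -> U}) :
  f =1 id -> g =1 id -> forall u, tens_map f g u = u.
Proof.
move=> fE gE u; apply: (@tens_ext _ _ _ _ (tens_map f g) idfun) => x y /=.
by rewrite tens_map_tmul fE gE.
Qed.

Lemma tens_map_cancel N N' U V (f : {linear N -> N'}) (f' : {linear N' -> N})
    (g : {linear U -> V}) (g' : {linear V -> U}) :
  cancel f f' -> cancel g g' -> cancel (tens_map f g) (tens_map f' g').
Proof.
move=> fK gK u.
rewrite -(@tens_map_comp _ _ _ _ _ _ _ _ _ _ idfun idfun) ?tens_map_id // => x /=.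
by rewrite fK.
by rewrite gK.
Qed.

Lemma tens_mapD N N' U V (f : {linear N -> N'}) (g g' h : {linear U -> V}) :
  (forall y, h y = g y + g' y) ->
  forall u, tens_map f h u = tens_map f g u + tens_map f g' u.
Proof.
move=> hE u.
apply: (@tens_ext _ _ _ _ (tens_map f h) (tens_map f g \+ tens_map f g')) => x y /=.
by rewrite !tens_map_tmul hE tmulDr.
Qed.

Lemma tens_map0r N N' U V (f : {linear N -> N'}) (g : {linear U -> V}) :
  (forall y, g y = 0) -> forall u, tens_map f g u = 0.
Proof.
move=> g0 u; apply: (@tens_ext _ _ _ _ (tens_map f g) \0) => x y /=.
by rewrite tens_map_tmul g0 tmulr0.
Qed.

Section RightExact.
Variables (N : lmodType R^c) (U V W : lmodType R).
Variables (f : {linear U -> V}) (g : {linear V -> W}).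
Local Notation Nf := (tens_map (idfun : {linear N -> N}) f).
Local Notation Ng := (tens_map (idfun : {linear N -> N}) g).
Hypothesis g_epi : forall z, exists y, g y = z.

Lemma tens_map_surj : forall z, exists y, Ng y = z.
Proof.
move: g_epi => /choice[s gs] z.
exists (\sum_(p <- tens_repr z) tmul p.1 (s p.2)).
rewrite linear_sum [RHS]tens_sum; apply: eq_bigr => p _ /=.
by rewrite tens_map_tmul gs.
Qed.

(* Lifting words along a section [s] of [g] respects the tensor relations up to the *)
(* image of [N (x) f]. *)
Lemma tens_map_exact : exact_at f g -> exact_at Nf Ng.
Proof.
move=> fg; move: g_epi => /choice[s gs].
pose im (v : tens N V) := exists u, Nf u = v.
have im0 : im 0 by exists 0; rewrite linear0.
have imD v v' : im v -> im v' -> im (v + v').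
  by move=> [u <-] [u' <-]; exists (u + u'); rewrite linearD.
have imN v : im v -> im (- v) by move=> [u <-]; exists (- u); rewrite linearN.
have im_tmul x y : g y = 0 -> im (tmul x y).
  by move=> /fg[a <-]; exists (tmul x a); rewrite tens_map_tmul.
have tmulBr x y y' : tmul x (y - y') = tmul x y - tmul x y' :> tens N V.
  by apply/eqP; rewrite eq_sym subr_eq -tmulDr subrK.
have gsB x y y' : g y = g y' -> im (tmul x y - tmul x y').
  by move=> yy'; rewrite -tmulBr; apply: im_tmul; rewrite linearB yy' subrr.
pose lift (t : seq (N * W)) : tens N V := \sum_(p <- t) tmul p.1 (s p.2).
have lift_rel t t' : tens_rel t t' -> im (lift t - lift t').
  rewrite /lift; elim=> {t t'} [t|t t' _ IH|t t' t'' _ IH _ IH'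
      |t t1 t' t1' _ IHt _ IHt'|t t'|y|x x' y|x y y'|x r y].
  - by rewrite subrr.
  - by rewrite -opprB; apply: imN.
  - by rewrite -[X in im X](subrKA (\sum_(p <- t') tmul p.1 (s p.2))); apply: imD.
  - by rewrite !big_cat /= opprD addrACA; apply: imD.
  - by rewrite !big_cat /= addrC subrr.
  - by rewrite big_cons !big_nil /= tmul0r addr0 subr0.
  - by rewrite !big_cons !big_nil /= !addr0 tmulDl subrr.
  (* The section [s] is not additive; the two lifts agree only after applying [g], hence differ by
     an element of the image. *)
  - rewrite !big_cons !big_nil /= !addr0 -tmulDr.
    by apply: gsB; rewrite linearD !gs.
  - rewrite !big_cons !big_nil /= !addr0 tmul_balanced.
    by apply: gsB; rewrite linearZ_LR !gs.
move=> u; split=> [gu0|[v <-]] /=; last first.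
  rewrite -(@tens_map_comp _ _ _ _ _ _ _ _ _ _ idfun \0) // ?tens_map0r //.
  by move=> y /=; apply/esym/fg; exists y.
have := gu0; rewrite {1}(tens_sum u) linear_sum.
pose w := [seq (p.1, g p.2) | p <- tens_repr u].
have -> : \sum_(p <- tens_repr u) Ng (tmul p.1 p.2) = tens_pi w.
  rewrite /w; elim: (tens_repr u) => [|p r IHr]; first by rewrite big_nil.
  by rewrite big_cons IHr -cat1s map_cat tens_pi_cat tens_map_tmul.
rewrite -tens_pi_nil => /tens_piP/lift_rel.
rewrite {2}/lift big_nil subr0 => w_im.
(* The difference of [u] and [lift w] is a sum of terms [tmul x y - tmul x (s (g y))], each of them
   in the image. *)
suff : im (u - lift w) by move/imD => /(_ _ w_im); rewrite subrK.
rewrite /lift /w {1}(tens_sum u) big_map -sumrB.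
elim/big_ind: _ => // p _; apply: gsB.
by rewrite gs.
Qed.
End RightExact.
End TensorMaps.

Lemma tens_map_swap (R : pzRingType) (N N' : lmodType R^c) (U V : lmodType R)
    (f : {linear N -> N'}) (g : {linear U -> V}) u :
  tens_map f (idfun : {linear V -> V}) (tens_map (idfun : {linear N -> N}) g u) =
  tens_map (idfun : {linear N' -> N'}) g (tens_map f (idfun : {linear U -> U}) u).
Proof.
rewrite -(tens_map_comp (h := f) (k := g)) // ?[RHS](tens_map_comp (h := f) (k := g)) //.
by rewrite -(tens_map_comp (h := f) (k := g)).
Qed.

(** * Flatness of a product of two modules *)

Section FlatProduct.
Variables (R : pzRingType) (U V : lmodType R).
Let p1 : {linear (U * V)%type -> U} := fst.
Let p2 : {linear (U * V)%type -> V} := snd.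
Let i1 : {linear U -> (U * V)%type} := pairing idfun \0.
Let i2 : {linear V -> (U * V)%type} := pairing \0 idfun.
Local Notation t N h := (tens_map (idfun : {linear N -> N}) h).

Lemma tens_prodE (N : lmodType R^c) (u : tens N (U * V)%type) :
  u = t N i1 (t N p1 u) + t N i2 (t N p2 u).
Proof.
rewrite -(tens_map_comp (h := idfun) (k := i1 \o p1)) //.
rewrite -(tens_map_comp (h := idfun) (k := i2 \o p2)) //.
rewrite -(tens_mapD _ (h := idfun)) ?tens_map_id // => -[x y].
by congr pair; rewrite /= ?addr0 ?add0r.
Qed.

(** By [tens_prodE] an element is determined by, and rebuilt from, its two projections, so each
    property is checked on the factors. *)
Lemma flat_prod : flat U -> flat V -> flat (U * V)%type.
Proof.
move=> Ufl Vfl A A' A'' f g fg.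
have [f1_inj fg1 g1_epi] := Ufl _ _ _ _ _ fg.
have [f2_inj fg2 g2_epi] := Vfl _ _ _ _ _ fg.
split.
- apply: linear_injP => u fu; rewrite (tens_prodE u).
  have -> : t _ p1 u = 0 by apply: f1_inj; rewrite /= tens_map_swap fu !linear0.
  have -> : t _ p2 u = 0 by apply: f2_inj; rewrite /= tens_map_swap fu !linear0.
  by rewrite !linear0 addr0.
- move=> u; split=> [gu|[v <-]] /=.
    have /fg1[v1 v1E] : tens_map g idfun (t _ p1 u) = 0.
      by rewrite tens_map_swap gu linear0.
    have /fg2[v2 v2E] : tens_map g idfun (t _ p2 u) = 0.
      by rewrite tens_map_swap gu linear0.
    exists (t _ i1 v1 + t _ i2 v2).
    by rewrite linearD /= !tens_map_swap v1E v2E -tens_prodE.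
  rewrite [LHS]tens_prodE.
  have -> : t _ p1 (tens_map g idfun (tens_map f idfun v)) = 0.
    by rewrite -2!tens_map_swap; apply/fg1; exists (t _ p1 v).
  have -> : t _ p2 (tens_map g idfun (tens_map f idfun v)) = 0.
    by rewrite -2!tens_map_swap; apply/fg2; exists (t _ p2 v).
  by rewrite !linear0 addr0.
move=> w; have [v1 v1E] := g1_epi (t _ p1 w); have [v2 v2E] := g2_epi (t _ p2 w).
exists (t _ i1 v1 + t _ i2 v2).
by rewrite linearD /= !tens_map_swap v1E v2E -tens_prodE.
Qed.
End FlatProduct.

(** * Gorenstein flat modules *)

Section FlatSteps.
Variables (R : pzRingType) (B : lmodType R^c -> Prop).
Implicit Types U V W Z : lmodType R.
Local Notation t N h := (tens_map (idfun : {linear N -> N}) h).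
Local Notation GF := (gorenstein_flat B).

(* Since [N (x) -] is right exact, injectivity is all it takes to keep the sequence *)
(* exact. *)
Definition flat_step U V W (f : {linear U -> V}) (g : {linear V -> W}) : Prop :=
  [/\ short_exact f g, flat V & forall N, B N -> injective (t N f)].

Lemma flat_step_tens U V W (f : {linear U -> V}) (g : {linear V -> W}) N :
  flat_step f g -> B N -> short_exact (t N f) (t N g).
Proof.
move=> [[_ fg g_epi] _ Nf_inj] BN.
by split; [exact: Nf_inj|exact: tens_map_exact|exact: tens_map_surj].
Qed.

(** One link of a resolution, kept as data so that a family of links indexed by the integers can be
    spliced. *)
Record flat_ext U W := FlatExt {
  ext_mid : lmodType R;
  ext_in : {linear U -> ext_mid};
  ext_out : {linear ext_mid -> W};
  extP : flat_step ext_in ext_out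
}.

(** The cycles in [gorenstein_flat] are given only up to isomorphism; this and the next lemma adjust
    either end of a link. *)
Lemma flat_ext_isol U U' W :
  isomorphic U' U -> flat_ext U W -> inhabited (flat_ext U' W).
Proof.
move=> /isomorphic_inv[e [e' [eK e'K]]] [V f g [[f_inj fg g_epi] Vfl Nf_inj]].
split; apply: (@FlatExt _ _ V (f \o e) g); split=> [|//|N BN].
  split=> //; first exact: inj_comp f_inj (can_inj eK).
  move=> y; split=> [/fg[x <-]|[x <-]]; last by apply/fg; exists (e x).
  by exists (e' x); rewrite /= e'K.
apply: (eq_inj (f := t N f \o t N e)).
  apply: inj_comp (Nf_inj _ BN) (can_inj (tens_map_cancel (f' := idfun) _ eK)).
  by [].
by move=> u; apply/esym/tens_map_comp.
Qed.

Lemma flat_ext_isor U W W' :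
  isomorphic W' W -> flat_ext U W -> inhabited (flat_ext U W').
Proof.
move=> /isomorphic_inv[e [e' [eK e'K]]] [V f g [[f_inj fg g_epi] Vfl Nf_inj]].
split; apply: (@FlatExt _ _ V f (e' \o g)); split=> //; split=> // [y|z].
  rewrite -fg /=; split=> [e'0|->]; last exact: linear0.
  by rewrite -[LHS]e'K e'0 linear0.
by have [y yz] := g_epi (e z); exists y; rewrite /= yz eK.
Qed.

(** The composites of [ext_out] with the next [ext_in] form an exact complex of flat modules with
    [Z 0] as its cycles in degree 0. The tensored links are short exact too, so the same splicing
    works after applying a module of [B]. *)
Lemma gf_splice (Z : int -> lmodType R) :
  (forall k, inhabited (flat_ext (Z k) (Z (k - 1)))) -> GF (Z 0).
Proof.
move=> H; pose E k := inhabited_witness (H k); clearbody E.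
pose d k : {linear ext_mid (E k) -> ext_mid (E (k - 1))} :=
  ext_in (E (k - 1)) \o ext_out (E k).
have dE : exact_at (ext_in (E 0)) (d 0).
  have [[_ fg _] _ _] := extP (E 0); have [[in_inj _ _] _ _] := extP (E (0 - 1)).
  move=> y; rewrite -fg /=; split=> [/eqP|->]; last by rewrite linear0.
  by rewrite -(linear0 (ext_in (E (0 - 1)))) => /eqP/in_inj.
have d_exact k : exact_at (d k) (d (k - 1)).
  have [[_ _ q_epi] _ _] := extP (E k).
  have [[_ fg _] _ _] := extP (E (k - 1)).
  have [[i_inj _ _] _ _] := extP (E (k - 1 - 1)).
  exact: (splice_exact q_epi fg i_inj).
have dd k x : d (k - 1) (d k x) = 0 by apply/d_exact; exists x.
exists (Complex dd); split=> [//|m|N BN k|].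
- by case: (extP (E m)).
- have [_ _ q_epi] := flat_step_tens (extP (E k)) BN.
  have [_ fg _] := flat_step_tens (extP (E (k - 1))) BN.
  have [i_inj _ _] := flat_step_tens (extP (E (k - 1 - 1))) BN.
  by apply: (splice_exact q_epi fg i_inj) => u; apply: tens_map_comp.
have [[in_inj _ _] _ _] := extP (E 0).
pose F := Complex dd.
have [e eE] : exists e : {linear Z 0 -> cycles F 0}, forall z, val (e z) = ext_in (E 0) z.
  apply: (lift_mono (i := (val : {linear cycles F 0 -> F 0}))) => [|z].
    exact: val_inj.
  have zP : ker_pred (cdiff F 0) (ext_in (E 0) z) by apply/eqP/dE; exists z.
  by exists (exist (fun x => ker_pred _ x) _ zP).
have [e' e'E] : exists e' : {linear cycles F 0 -> Z 0},
    forall x, ext_in (E 0) (e' x) = val x.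
  apply: (lift_mono (h := (val : {linear cycles F 0 -> F 0}))) => // x.
  by apply/dE; case: x => x /= /eqP.
exists e, e' => x; first by apply: in_inj; rewrite e'E eE.
by apply: val_inj; rewrite eE e'E.
Qed.


(** This reverses [gf_splice], cutting a complex into links. The real point is that the inclusion of
    cycles stays injective after tensoring. *)
Lemma cycles_ext (F : complex R) :
  exact_complex F -> (forall m, flat (F m)) ->
  (forall N, B N -> exact_complex (tens_mod_complex N F)) ->
  forall k, inhabited (flat_ext (cycles F k) (cycles F (k - 1))).
Proof.
move=> F_exact F_flat F_tens k.
pose v m : {linear cycles F m -> F m} := val.
have v_inj m : injective (v m) by exact: val_inj.
have out_ex m : exists o : {linear F m -> cycles F (m - 1)},
    [/\ forall x, v _ (o x) = cdiff F m x, exact_at (v m) o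
      & forall z, exists x, o x = z].
  have [o oE] : exists o : {linear F m -> cycles F (m - 1)},
      forall x, v _ (o x) = cdiff F m x.
    apply: lift_mono => // x.
    have xP : ker_pred (cdiff F (m - 1)) (cdiff F m x) by apply/eqP/cdiffK.
    by exists (exist (fun y => ker_pred _ y) _ xP).
  exists o; split=> // [y|z].
    split=> [oy0|[x <-]].
      have yP : ker_pred (cdiff F m) y by rewrite /ker_pred -oE oy0 linear0.
      by exists (exist (fun x => ker_pred _ x) _ yP).
    by apply: v_inj; rewrite oE linear0; apply/eqP; case: x.
  have /F_exact[x xz] : cdiff F (m - 1) (v _ z) = 0 by apply/eqP; case: z.
  by exists x; apply: v_inj; rewrite oE.
have [o [oE vo o_epi]] := out_ex k.
split; apply: (@FlatExt _ _ (F k) (v k) o); split=> // N BN.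
(* Exactness is stated at degrees [m - 1]; writing [k] as [m - 1 - 1] makes room for the two terms
   above it. *)
have [m ->] : exists m, k = m - 1 - 1 by exists (k + 1 + 1); rewrite !addrK.
have [o' [o'E _ o'_epi]] := out_ex (m - 1).
have do' : exact_at (cdiff F m) o'.
  move=> y; rewrite -F_exact -o'E; split=> [->|vo'0]; first by rewrite linear0.
  by apply: v_inj; rewrite vo'0 linear0.
(* A lift [w] of [u] is a cycle of the tensored complex, hence a boundary, and boundaries die under
   the tensored [o']. *)
apply: linear_injP => u vu0; have [w wu] := tens_map_surj o'_epi u.
have /(F_tens N BN)[w' w'w] : tens_mod_diff N F (m - 1) w = 0.
  rewrite /tens_mod_diff /=.
  rewrite (tens_map_comp (f := idfun) (f' := idfun) (g := o') (g' := v _)) //.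
    by rewrite wu.
  by move=> x; rewrite -o'E.
by rewrite -wu; apply/(tens_map_exact o'_epi do'); exists w'.
Qed.

(** Shifting the links of [F] by [k] moves [cycles F k] to index 0. *)
Lemma gf_cycles (F : complex R) :
  exact_complex F -> (forall m, flat (F m)) ->
  (forall N, B N -> exact_complex (tens_mod_complex N F)) ->
  forall k, GF (cycles F k).
Proof.
move=> F_exact F_flat F_tens k; rewrite -[k]add0r.
apply: (gf_splice (Z := fun j => cycles F (j + k))) => j.
by rewrite addrAC; apply: cycles_ext.
Qed.

Lemma gf_left M : GF M -> exists2 K, GF K & inhabited (flat_ext K M).
Proof.
case=> F [F_exact F_flat F_tens M_iso].
exists (cycles F 1); first exact: gf_cycles.
have [E] := cycles_ext F_exact F_flat F_tens 1; move: E; rewrite subrr.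
exact: flat_ext_isor.
Qed.

Lemma gf_right M : GF M -> exists2 C, GF C & inhabited (flat_ext M C).
Proof.
case=> F [F_exact F_flat F_tens M_iso].
exists (cycles F (0 - 1)); first exact: gf_cycles.
by have [E] := cycles_ext F_exact F_flat F_tens 0; apply: flat_ext_isol E.
Qed.

(** The split sequence from [P] to [P * P] to [P] serves as every link; being split, it stays
    injective under any tensor product. *)
Lemma gf_flat P : flat P -> GF P.
Proof.
move=> Pfl; apply: (gf_splice (Z := fun=> P)) => _.
pose i : {linear P -> (P * P)%type} := pairing idfun \0.
split; apply: (@FlatExt _ _ (P * P)%type i snd); split.
- split=> [x y [] //|[a b]|b]; last by exists (0, b).
  by split=> /= [->|[x [_ <-]] //]; exists a.
- exact: flat_prod.
by move=> N _; apply: can_inj (tens_map_cancel (f' := idfun) (g' := fst) _ _).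
Qed.

Hypothesis B_ext : closed_under_extensions GF.

(** The kernel [K'] of [g] is the pullback of [ext_out E] and [- c]: it projects onto [P'] with
    kernel [K], so closure under extensions applies. *)
Lemma gf_pullback (K M P' : lmodType R) (E : flat_ext K M) (c : {linear P' -> M}) :
  GF K -> flat P' ->
  let g := (ext_out E \o fst) \+ (c \o snd) in
  exists (K' : lmodType R) (i : {linear K' -> (ext_mid E * P')%type}),
    GF K' /\ flat_step i g.
Proof.
case: E => P f p [[f_inj fp p_epi] Pfl Nf_inj] /= GK P'fl.
set g : {linear (P * P')%type -> M} := (p \o fst) \+ (c \o snd).
have [K' [v [v_inj vg]]] := kernel_ex g.
have [j jE] : exists j : {linear K -> K'},
    forall x, v (j x) = pairing f (\0 : {linear K -> P'}) x.
  apply: lift_mono => // x; apply/vg; rewrite /= linear0 addr0.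
  by apply/fp; exists x.
pose q : {linear K' -> P'} := snd \o v.
have jq : short_exact j q.
  split=> [x y /(congr1 v)|y|z]; first by rewrite !jE => -[/f_inj].
    split=> [qy0|[x <-]]; last by rewrite /q /= jE.
    have : g (v y) = 0 by apply/vg; exists y.
    rewrite /= (_ : (v y).2 = 0) // linear0 addr0 => /fp[x xy].
    exists x; apply: v_inj; rewrite jE [RHS]surjective_pairing.
    by congr pair; [exact: xy|exact: esym qy0].
  have [a az] := p_epi (- c z).
  have /vg[x xE] : g (a, z) = 0 by rewrite /= az addNr.
  by exists x; rewrite /q /= xE.
exists K', v; split; first exact: B_ext jq GK (gf_flat P'fl).
split=> [|| N BN]; last 2 first.
- exact: flat_prod.
(* An element [u] killed by the tensored [v] vanishes over [P'], so it comes from some [w] over [K];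
   the first coordinate then gives that the tensored [f] kills [w]. *)
- apply: linear_injP => u vu0.
  have : t N q u = 0.
    by rewrite (tens_map_comp (f := idfun) (f' := idfun) (g := v) (g' := snd)) // vu0 linear0.
  have [_ jq_exact q_epi] := jq.
  move=> /(tens_map_exact q_epi jq_exact)[w wu].
  suff -> : u = t N j 0 by rewrite linear0.
  rewrite -wu; congr (t N j _); apply: (Nf_inj _ BN); rewrite linear0.
  rewrite (tens_map_comp (f := idfun) (f' := idfun) (g := v \o j) (g' := fst)) //.
    rewrite (tens_map_comp (f := idfun) (f' := idfun) (g := j) (g' := v)) //.
    by rewrite [X in t N v X]wu vu0 linear0.
  by move=> x /=; rewrite jE.
split=> // z; have [a az] := p_epi z.
by exists (a, 0); rewrite /= linear0 addr0.
Qed.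

(** Dually, the cokernel [C'] is an extension of [C] by [Q']. Injectivity after tensoring is seen on
    the first coordinate alone. *)
Lemma gf_pushout (M C Q' : lmodType R) (E : flat_ext M C) (c : {linear M -> Q'}) :
  GF C -> flat Q' ->
  exists (C' : lmodType R) (p : {linear (ext_mid E * Q')%type -> C'}),
    GF C' /\ flat_step (pairing (ext_in E) c) p.
Proof.
case: E => Q f p [[f_inj fp p_epi] Qfl Nf_inj] /= GC Q'fl.
pose h : {linear M -> (Q * Q')%type} := pairing f c.
have [C' [r [hr r_epi]]] := coker_ex h.
have [q qE] : exists q : {linear C' -> C}, forall x, q (r x) = (p \o fst) x.
  by apply: lift_epi => // x /hr[y <-] /=; apply/fp; exists y.
pose j : {linear Q' -> C'} := r \o pairing (\0 : {linear Q' -> Q}) idfun.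
have jq : short_exact j q.
  split.
  - apply: linear_injP => x /hr[y [fy0 cy]].
    have y0 : y = 0 by apply: f_inj; rewrite linear0.
    by rewrite -[LHS]cy y0 linear0.
  - move=> z; split=> [|[x <-]]; last by rewrite /= qE /= linear0.
    have [[a b] <-] := r_epi z; rewrite qE /= => /fp[y ya].
    (* Subtracting [h y = (a, c y)] from [(a, b)] leaves [(0, b - c y)] without changing the
       class. *)
    exists (b - c y); apply/eqP; rewrite -subr_eq0 -linearB; apply/eqP/hr.
    exists (- y); rewrite /= linearN.
    by congr pair; rewrite /= ?linearN /= ?ya ?sub0r // addrAC subrr sub0r.
  move=> z; have [a <-] := p_epi z.
  by exists (r (a, 0)); rewrite qE.
exists (C'), r; split; first exact: B_ext jq (gf_flat Q'fl) GC.
split=> [|| N BN]; last 2 first.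
- exact: flat_prod.
- move=> u w /(congr1 (t N fst)) uw; apply: (Nf_inj _ BN).
  by rewrite !(tens_map_comp (f := idfun) (f' := idfun) (g := h) (g' := fst)).
by split=> // x y [/f_inj].
Qed.


End FlatSteps.

(** * Gorenstein flat complexes *)

Section ComplexSteps.
Variables (R : pzRingType) (B : lmodType R^c -> Prop).
Local Notation GF := (gorenstein_flat B).
Hypothesis B_ext : closed_under_extensions GF.

(** Links between complexes are constrained degree by degree, which suffices since tensor products
    split over bidegrees. *)
Record flat_cext (X Z : complex R) := FlatCext {
  cext_mid : complex R;
  cext_in : chain_map X cext_mid;
  cext_out : chain_map cext_mid Z;
  cextP : forall m, flat_step B (cext_in m) (cext_out m)
}.

(* Needed because [m - 1 + 1] and [m] are not convertible. *)
Definition lin_cast (A : int -> lmodType R) p q (e : p = q) : {linear A p -> A q} :=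
  ecast x {linear A p -> A x} e idfun.

Lemma cdiff_lin_cast (P : int -> lmodType R) (X : complex R)
    (h : forall m, {linear P m -> X m}) m n (e : m = n) (e' : n - 1 = m - 1) a :
  lin_cast X e' (cdiff X n (h n (lin_cast P e a))) = cdiff X m (h m a).
Proof. by case: n / e e' => e'; rewrite (eq_irrelevance e' erefl). Qed.

Lemma lin_cast_cdiffK (X : complex R) m n (e : n - 1 = m) (x : X n) :
  cdiff X m (lin_cast X e (cdiff X n x)) = 0.
Proof. by case: m / e; apply: cdiffK. Qed.

Lemma gf_complex_left (X : complex R) : (forall m, GF (X m)) ->
  exists2 K : complex R, (forall m, GF (K m)) & inhabited (flat_cext K X).
Proof.
move=> GX.
have /choice[K0 K0P] m : exists K, GF K /\ inhabited (flat_ext B K (X m)).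
  by have [K GK EK] := gf_left (GX m); exists K.
pose E m := inhabited_witness (K0P m).2; clearbody E.
pose P m := ext_mid (E m).
pose p m : {linear P m -> X m} := ext_out (E m).
have Pfl m : flat (P m) by case: (extP (E m)).
pose c m : {linear P (m + 1) -> X m} :=
  lin_cast X (addrK 1 m) \o (cdiff X (m + 1) \o p (m + 1)).
(* The map [(a, b)] to [(0, a)] makes [L] the sum of the disks on [P n] in degrees [n] and [n - 1];
   the [p n] extend to the chain map [g]. *)
pose d m : {linear (P m * P (m + 1)%R)%type -> (P (m - 1)%R * P (m - 1 + 1)%R)%type} :=
  pairing \0 (lin_cast P (esym (subrK 1 m)) \o fst).
have dd m x : d (m - 1) (d m x) = 0 by congr pair; rewrite /= linear0.
pose L := Complex dd.
pose g m : {linear L m -> X m} := (p m \o fst) \+ (c m \o snd).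
have gd m x : g (m - 1) (cdiff L m x) = cdiff X m (g m x).
  case: x => a b; rewrite /g /= linear0 add0r linearD /= lin_cast_cdiffK addr0.
  exact: cdiff_lin_cast.
have /choice[K KP] m :
    exists K : lmodType R, exists i : {linear K -> L m}, GF K /\ flat_step B i (g m).
  exact: (gf_pullback B_ext (E m) (c m) (K0P m).1 (Pfl (m + 1))).
pose i m := projT1 (cid (KP m)).
have iP m : GF (K m) /\ flat_step B (i m) (g m) := projT2 (cid (KP m)).
clearbody i.
have i_inj m : injective (i m) by case: (iP m) => _ [[]].
have ig m : exact_at (i m) (g m) by case: (iP m) => _ [[]].
have dK_ex m : exists dK : {linear K m -> K (m - 1)},
    forall x, i _ (dK x) = (cdiff L m \o i m) x.
  apply: lift_mono => // x; apply/ig; apply: etrans (gd _ _) _.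
  by rewrite (_ : g m _ = 0) ?linear0 //; apply/ig; exists x.
pose dK m := projT1 (cid (dK_ex m)).
have dKE m x : i _ (dK m x) = cdiff L m (i m x) := projT2 (cid (dK_ex m)) x.
clearbody dK.
have ddK m x : dK (m - 1) (dK m x) = 0.
  by apply: i_inj; rewrite !dKE cdiffK linear0.
exists (Complex ddK) => [m|]; first exact: (iP m).1.
split; apply: (@FlatCext (Complex ddK) X L (@ChainMap _ (Complex ddK) L i dKE)
  (@ChainMap _ L X g gd)) => m.
exact: (iP m).2.
Qed.

Lemma gf_complex_right (X : complex R) : (forall m, GF (X m)) ->
  exists2 C : complex R, (forall m, GF (C m)) & inhabited (flat_cext X C).
Proof.
move=> GX.
have /choice[C0 C0P] m : exists C, GF C /\ inhabited (flat_ext B (X m) C).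
  by have [C GC EC] := gf_right (GX m); exists C.
pose E m := inhabited_witness (C0P m).2; clearbody E.
pose Q m := ext_mid (E m).
pose h m : {linear X m -> Q m} := ext_in (E m).
have Qfl m : flat (Q m) by case: (extP (E m)).
pose c m : {linear X m -> Q (m - 1)} := h (m - 1) \o cdiff X m.
(* Here [(a, b)] goes to [(b, 0)]: disks on [Q n] in degrees [n + 1] and [n], receiving [X] by [x]
   to [(h x, h (d x))]. *)
pose d m : {linear (Q m * Q (m - 1)%R)%type -> (Q (m - 1)%R * Q (m - 1 - 1)%R)%type} :=
  pairing snd \0.
have dd m x : d (m - 1) (d m x) = 0 by [].
pose L := Complex dd.
pose f m : {linear X m -> L m} := pairing (h m) (c m).
have fd m x : f (m - 1) (cdiff X m x) = cdiff L m (f m x).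
  by congr pair; rewrite /c /= cdiffK linear0.
have /choice[C CP] m :
    exists C : lmodType R, exists p : {linear L m -> C}, GF C /\ flat_step B (f m) p.
  exact: (gf_pushout B_ext (E m) (c m) (C0P m).1 (Qfl (m - 1))).
pose p m := projT1 (cid (CP m)).
have pP m : GF (C m) /\ flat_step B (f m) (p m) := projT2 (cid (CP m)).
clearbody p.
have p_epi m z : exists y, p m y = z.
  by case: (pP m) => _ [[_ _]] /(_ z).
have fp m : exact_at (f m) (p m) by case: (pP m) => _ [[]].
have dC_ex m : exists dC : {linear C m -> C (m - 1)},
    forall x, dC (p m x) = (p (m - 1) \o cdiff L m) x.
  apply: lift_epi => // y /fp[x <-]; apply/fp; exists (cdiff X m x).
  exact: fd.
pose dC m := projT1 (cid (dC_ex m)).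
have dCE m x : dC m (p m x) = p (m - 1) (cdiff L m x) := projT2 (cid (dC_ex m)) x.
clearbody dC.
have ddC m x : dC (m - 1) (dC m x) = 0.
  by have [y <-] := p_epi m x; rewrite !dCE cdiffK linear0.
exists (Complex ddC) => [m|]; first exact: (pP m).1.
split; apply: (@FlatCext X (Complex ddC) L (@ChainMap _ X L f fd)
  (@ChainMap _ L (Complex ddC) p (fun m x => esym (dCE m x)))) => m.
exact: (pP m).2.
Qed.

Lemma gf_complex_splice_ex (X : complex R) : (forall m, GF (X m)) ->
  exists2 Z : int -> complex R,
    Z 0 = X & forall k, inhabited (flat_cext (Z k) (Z (k - 1))).
Proof.
move=> GX.
(* To be iterated, [left] must be defined on all complexes; [Y] itself is the default witness when
   some component is not Gorenstein flat. *)
have /choice[left leftP] (Y : complex R) : exists K : complex R, (forall m, GF (Y m)) ->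
    (forall m, GF (K m)) /\ inhabited (flat_cext K Y).
  have [/gf_complex_left[K]|nGY] := pselect (forall m, GF (Y m)); first by exists K.
  by exists Y => GY; case: nGY.
have /choice[right rightP] (Y : complex R) : exists C : complex R, (forall m, GF (Y m)) ->
    (forall m, GF (C m)) /\ inhabited (flat_cext Y C).
  have [/gf_complex_right[C]|nGY] := pselect (forall m, GF (Y m)); first by exists C.
  by exists Y => GY; case: nGY.
have Gl n : forall m, GF (iter n left X m).
  by elim: n => //= n /leftP[].
have Gr n : forall m, GF (iter n right X m).
  by elim: n => //= n /rightP[].
(* Since [Negz n] is [- n.+1], it takes [n.+1] steps to the right. *)
exists (fun k => match k with Posz n => iter n left X | Negz n => iter n.+1 right X end) => //.
case=> [[|n]|n].
- exact: (rightP X (Gr 0%N)).2.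
- have -> : n.+1%:Z - 1 = n by rewrite intS addrC addKr.
  exact: (leftP _ (Gl n)).2.
have -> : Negz n - 1 = Negz n.+1 by rewrite !NegzE -opprD -PoszD addn1.
exact: (rightP _ (Gr n.+1)).2.
Qed.

End ComplexSteps.

(** * Sums of spheres and splicing of complexes *)

Lemma sphere_sum_component (R : pzRingType) (N : int -> lmodType R) p :
  isomorphic (N p) (dsum_complex (fun m => sphere m (N m)) p).
Proof.
(* The test [p == p] sits inside a type; abstracting it to [b] lets the conditional reduce. *)
have iso_true (M : lmodType R) (b : bool) : b -> isomorphic M (if b then M else 'rV[R]_0).
  by move=> ->; exists idfun; exists id.
have zero_false (M : lmodType R) (b : bool) : ~~ b ->
    forall z : if b then M else 'rV[R]_0, z = 0.
  by case: b => //= _ z; apply: thinmx0.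
have /isomorphic_inv[e [e' [eK e'K]]] : isomorphic (N p) (sphere_obj p (N p) p).
  exact: iso_true (eqxx p).
pose A i : lmodType R := sphere_obj i (N i) p.
exists (dsum_inj (A := A) p \o e); exists (fun u : dsum A => e' (val u p)) => x /=.
  by rewrite dfwithin eK.
apply: dsum_ext => j /=; have [<-|pj] := eqVneq p j; first by rewrite dfwithin e'K.
by rewrite dfwithout // [RHS]zero_false.
Qed.

Lemma tens_exact_iso (R : pzRingType) (N N' : lmodType R^c) (U V W : lmodType R)
    (f : {linear U -> V}) (g : {linear V -> W}) :
  isomorphic N N' ->
  exact_at (tens_map (idfun : {linear N' -> N'}) f) (tens_map (idfun : {linear N' -> N'}) g) ->
  exact_at (tens_map (idfun : {linear N -> N}) f) (tens_map (idfun : {linear N -> N}) g).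
Proof.
move=> /isomorphic_inv[e [e' [eK e'K]]].
apply: (exact_at_retract (sA := tens_map e idfun) (rA := tens_map e' idfun)
  (sB := tens_map e idfun) (rB := tens_map e' idfun)
  (sC := tens_map e idfun) (rC := tens_map e' idfun)) => x /=.
- exact: (tens_map_cancel eK (g' := idfun)).
- exact: (tens_map_cancel eK (g' := idfun)).
- exact: tens_map_swap.
- exact: tens_map_swap.
- exact: tens_map_swap.
Qed.

Lemma gf_complex_splice (R : pzRingType) (B : lmodType R^c -> Prop) (Z : int -> complex R) :
  (forall k, inhabited (flat_cext B (Z k) (Z (k - 1)))) ->
  gorenstein_flat_complex (@sum_of_spheres R^c B) (Z 0).
Proof.
move=> H; pose E k := inhabited_witness (H k); clearbody E.
pose L k := cext_mid (E k).
pose d0 k m : {linear L k m -> L (k - 1) m} :=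
  cext_in (E (k - 1)) m \o cext_out (E k) m.
have d0d k m x : d0 k (m - 1) (cdiff (L k) m x) = cdiff (L (k - 1)) m (d0 k m x).
  by rewrite /d0 /= !cmap_diff.
pose d k : chain_map (L k) (L (k - 1)) := ChainMap (d0d k).
have dE m : exact_at (cext_in (E 0) m) (d 0 m).
  have [[_ fg _] _ _] := cextP (E 0) m; have [[in_inj _ _] _ _] := cextP (E (0 - 1)) m.
  move=> y; rewrite -fg /=; split=> [/eqP|->]; last by rewrite linear0.
  by rewrite -(linear0 (cext_in (E (0 - 1)) m)) => /eqP/in_inj.
have d_exact k m : exact_at (d k m) (d (k - 1) m).
  have [[_ _ q_epi] _ _] := cextP (E k) m.
  have [[_ fg _] _ _] := cextP (E (k - 1)) m.
  have [[i_inj _ _] _ _] := cextP (E (k - 1 - 1)) m.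
  exact: (splice_exact q_epi fg i_inj).
have dd k m x : d (k - 1) m (d k m x) = 0 by apply/d_exact; exists x.
pose F := Complex2 dd.
exists F; split=> [//|k U V W f g fg m|T [N [BN T_iso]] k m|].
- apply/dsum_map_short_exact => pq; have [_ Lfl _] := cextP (E k) (val pq).2.
  exact: Lfl.
- apply/dsum_map_exact => -[[p q] pq].
  (* In bidegree [(p, q)] one tensors with [T p], which is only isomorphic to the module [N p] of
     [B]; exactness is proved for [N p] and transported. *)
  have [T_N T_Nbij] := T_iso.
  have NT := sphere_sum_component N p.
  have TN : isomorphic (T p) (N p).
    have /isomorphic_inv[a [b [aK bK]]] := NT.
    exists (b \o T_N p); apply: bij_comp (T_Nbij p); by exists a.
  apply: (tens_exact_iso TN).
  have [_ _ q_epi] := flat_step_tens (cextP (E k) q) (BN p).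
  have [_ fg _] := flat_step_tens (cextP (E (k - 1)) q) (BN p).
  have [i_inj _ _] := flat_step_tens (cextP (E (k - 1 - 1)) q) (BN p).
  by apply: (splice_exact q_epi fg i_inj) => u; apply: tens_map_comp.
have in_inj m : injective (cext_in (E 0) m) by case: (cextP (E 0) m) => [[]].
pose v m : {linear cycles2 F 0 m -> F 0 m} := val.
have v_inj m : injective (v m) by exact: val_inj.
have vP m x : c2diff F 0 m (v m x) = 0 by apply/eqP; case: x.
have e_ex m : exists e : {linear Z 0 m -> cycles2 F 0 m},
    forall z, v m (e z) = cext_in (E 0) m z.
  apply: lift_mono => // z.
  have zP : ker_pred (c2diff F 0 m) (cext_in (E 0) m z) by apply/eqP/dE; exists z.
  by exists (exist (fun x => ker_pred _ x) _ zP).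
pose e m := projT1 (cid (e_ex m)).
have eE m z : v m (e m z) = cext_in (E 0) m z := projT2 (cid (e_ex m)) z.
clearbody e.
have ed m z : e (m - 1) (cdiff (Z 0) m z) = cdiff (cycles2 F 0) m (e m z).
  apply: v_inj; rewrite eE cmap_diff -eE; exact: erefl.
exists (@ChainMap _ (Z 0) (cycles2 F 0) e ed) => m /=.
have [e' e'E] : exists e' : {linear cycles2 F 0 m -> Z 0 m},
    forall x, cext_in (E 0) m (e' x) = v m x.
  by apply: lift_mono => // x; apply/dE/vP.
exists e' => x; first by apply: in_inj; rewrite e'E eE.
by apply: v_inj; rewrite eE e'E.
Qed.

(** * From complexes to their components *)

Section ConstantComplex.
Variable R : pzRingType.

(** The test object is [N] in every degree rather than one sphere, because every summand must lie in
    [B], which may contain no zero module. *)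
Definition const_complex (N : lmodType R) : complex R :=
  @Complex R (fun=> N) (fun=> \0) (fun _ _ => erefl).

Definition const_chain_map (U V : lmodType R) (f : {linear U -> V}) :
    chain_map (const_complex U) (const_complex V) :=
  @ChainMap R (const_complex U) (const_complex V) (fun=> f) (fun _ _ => linear0 f).

Lemma const_sum_of_spheres (B : lmodType R -> Prop) N :
  B N -> sum_of_spheres B (const_complex N).
Proof.
move=> BN; exists (fun=> N); split=> //.
have H p := sphere_sum_component (fun=> N) p.
pose e p := projT1 (cid (H p)).
have e_bij p : bijective (e p) := projT2 (cid (H p)).
have ed m x : e (m - 1) (cdiff (const_complex N) m x) =
    cdiff (dsum_complex (fun m => sphere m N)) m (e m x).
  by rewrite linear0; apply: dsum_ext.
by exists (@ChainMap R (const_complex N) _ e ed).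
Qed.
End ConstantComplex.

(** A short exact sequence of modules is tested as constant complexes; bidegree [(0, m)] shows it
    tensored with [L m]. *)
Lemma tens_flat_component (R : pzRingType) (L : complex R) m : tens_flat L -> flat (L m).
Proof.
move=> Lfl U V W f g fg.
have /(_ m)/dsum_map_short_exact H :
    short_exact_complex (tens_chain_map (const_chain_map f) (id_chain_map L))
                        (tens_chain_map (const_chain_map g) (id_chain_map L)).
  by apply: Lfl => n.
have pq : (0, m).1 + (0, m).2 == m :> int by rewrite add0r.
exact: H (exist (fun pq : int * int => pq.1 + pq.2 == m) (0, m) pq).
Qed.

Lemma gf_complex_component (R : pzRingType) (B : lmodType R^c -> Prop) (X : complex R) :
  gorenstein_flat_complex (@sum_of_spheres R^c B) X ->
  forall m, gorenstein_flat B (X m).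
Proof.
case=> F [F_exact F_flat F_tens [f f_bij]] m.
(* The row of [F] in degree [m]; cycles are taken degreewise, so [f m] is already the required
   isomorphism. *)
exists (@Complex R (fun k => F k m) (fun k => c2diff F k m) (fun k x => c2diffK x)).
split=> [k|k|N BN k|].
- exact: F_exact.
- exact: tens_flat_component (F_flat k).
- have /dsum_map_exact H := F_tens _ (const_sum_of_spheres BN) k m.
  have pq : (0, m).1 + (0, m).2 == m :> int by rewrite add0r.
  exact: H (exist (fun pq : int * int => pq.1 + pq.2 == m) (0, m) pq).
by exists (f m); apply: f_bij.
Qed.

Theorem proposition2p25 (R : pzRingType) (B : lmodType R^c -> Prop)
  (B_ext : closed_under_extensions (@gorenstein_flat R B)) :
  forall X : complex R,
    gorenstein_flat_complex (@sum_of_spheres R^c B) X <->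
    Ch_class (@gorenstein_flat R B) X.
Proof.
move=> X; split; first exact: gf_complex_component.
by move=> /(gf_complex_splice_ex B_ext)[Z <- Z_ext]; apply: gf_complex_splice.
Qed.
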